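(* Let $n\ge1$ and $d\ge0$, and let $M^1$ and $M^2$ be any two fC-matrices for $\mathcal P^\Phi_{n,d}$. Then $\mathsf{cg}(M^1)\subseteq\mathsf{cg}(M^2)$ if and only if both of the following hold: (a) $M^1\le_C M^2$; (b) if $M^1$ has type fRT2 or fRT4, then at least one of the following holds: (b1) $\min_0(M^2)\le\operatorname{\mu in}_0(M^1)$ and $\min_1(M^2)\le\operatorname{\mu in}_1(M^1)$, or (b2) $M^2$ also has type fRT2 or fRT4, and $\min_1(M^2)-\min_0(M^2)=\min_1(M^1)-\min_0(M^1)$.
   Context: **Partitions.** The partition monoid $\mathcal P_n$ ($n\ge1$) consists of all set partitions of $X\cup X'$, where $X=\{1,\dots,n\}$, $X'=\{1',\dots,n'\}$. A partition is identified with any graph on $X\cup X'$ whose connected components are its blocks. For $\alpha,\beta\in\mathcal P_n$, let $X''=\{1'',\dots,n''\}$; rename each lower vertex $x'$ of $\alpha$ as $x''$ and each upper vertex $x$ of $\beta$ as $x''$, and let the product graph $\Gamma(\alpha,\beta)$ on $X\cup X''\cup X'$ be the union of the two resulting graphs. The product $\alpha\beta$ is the partition in which $x,y\in X\cup X'$ lie in the same block iff they lie in the same connected component of $\Gamma(\alpha,\beta)$. $\Phi(\alpha,\beta)$ is the number of connected components of $\Gamma(\alpha,\beta)$ contained in $X''$. A transversal of $\alpha$ is a block meeting both $X$ and $X'$; $\operatorname{rank}\alpha$ is the number of transversals. $\widehat\alpha$ is the rank-$0$ partition obtained from $\alpha$ by splitting each transversal $A\cup B'$ into $A$ and $B'$.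 Green's relations $\mathscr R,\mathscr L,\mathscr H=\mathscr R\cap\mathscr L$ on $\mathcal P_n$ are the usual ones. If $\alpha\,\mathscr H\,\beta$ have rank $q$ and $\alpha$ has transversals $A_i\cup B_i'$ ($1\le i\le q$), then $\beta$ has transversals $A_i\cup B_{i\pi}'$ for some $\pi\in\mathcal S_q$ (symmetric group), and we put $\partial(\alpha,\beta)=\pi$; this is well defined up to conjugacy in $\mathcal S_q$. **$d$-twisted partition monoid.** $\mathcal P^\Phi_{n,d}=(\{0,1,\dots,d\}\times\mathcal P_n)\cup\{\mathbf 0\}$, where $(i,\alpha)(j,\beta)=(i+j+\Phi(\alpha,\beta),\alpha\beta)$ if $i+j+\Phi(\alpha,\beta)\le d$, and all other products equal $\mathbf 0$. **fC-matrices.** An fC-matrix is a matrix $M=(M_{qi})_{q\in\{0,\dots,n\},\,i\in\{0,\dots,d\}}$ with entries from $\{\Delta,\mu^\uparrow,\mu^\downarrow,\mu,R\}\cup\{N:\{\mathrm{id}_q\}\ne N\trianglelefteq\mathcal S_q,\ 2\le q\le n\}$ (entries of the second set are $N$-symbols) such that rows $0,1$ are jointly of one of the types fRT1–fRT4, each row $q\ge2$ is of type fRT5, and (V1), (V2) hold. ''$M$ has type fRT$k$'' ($1\le k\le 4$) refers to the type of rows $0$ and $1$. Below $j$ ranges over $\{0,\dots,d\}$ and $\zeta\in\{\mu,\mu^\uparrow,\mu^\downarrow,\Delta\}$. - fRT1: for some $0\le k\le d+1$: $M_{0j}=M_{1j}=\Delta$ for $j<k$ and $M_{0j}=M_{1j}=R$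 for $j\ge k$. - fRT2: for some $0\le i<k\le d$: $M_{0j}=\Delta$ for $j<i$, $\mu$ for $i\le j<k$, $R$ for $j\ge k$; $M_{1j}=\Delta$ for $j<i$, $M_{1i}=\zeta$, $M_{1j}=\mu$ for $i<j\le k$, $R$ for $j\ge k+1$. - fRT3: for some $0\le k<l\le d+1$: $M_{0j}=\Delta$ for $j<k$, $R$ for $j\ge k$; $M_{1j}=\Delta$ for $j<l-1$, $M_{1,l-1}=\zeta$, $M_{1j}=R$ for $j\ge l$. - fRT4: for some $0<k<l-1\le d$: $M_{0j}=\Delta$ for $j<k-1$, $M_{0,k-1}=\mu$, $M_{0j}=R$ for $j\ge k$; $M_{1j}=\Delta$ for $j<l-1$, $M_{1,l-1}=\mu$, $M_{1j}=R$ for $j\ge l$. - fRT5 (row $q\ge2$): for some $0\le i\le k\le d+1$ and non-trivial normal subgroups $N_i\le\cdots\le N_{k-1}$ of $\mathcal S_q$: $M_{qj}=\Delta$ for $j<i$, $N_j$ for $i\le j<k$, $R$ for $j\ge k$. - (V1) An $N$-symbol cannot be immediately above (position $(q,i)$ over position $(q-1,i)$) $\Delta$, $\mu^\uparrow$, $\mu^\downarrow$ or another $N$-symbol. - (V2) Every entry $R$ in a row $q\ge2$ is directly above an entry $R$ in row $q-1$. For an fC-matrix $M$, $\min_q(M)$ denotes the least $i$ with $M_{qi}=R$, or $d+1$ if row $q$ contains no $R$. For $M$ of type fRT2, $\operatorname{\mu in}_0(M)=i$ and $\operatorname{\mu in}_1(M)=i+1$, where $i$ is the least index with $M_{0i}=\mu$;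 for $M$ of type fRT4, $\operatorname{\mu in}_0(M)=k-1$ and $\operatorname{\mu in}_1(M)=l-1$, where $k=\min_0(M)$ and $l=\min_1(M)$. **The relation $\mathsf{cg}(M)$** on $\mathcal P_{n,d}^\Phi$ consists of all pairs $((i,\alpha),(j,\beta))$ such that, with $q=\operatorname{rank}\alpha$, $r=\operatorname{rank}\beta$, one of the following holds: - (fC1) $M_{qi}=M_{rj}=\Delta$, $i=j$ and $\alpha=\beta$; - (fC2) $M_{qi}=M_{rj}=R$; - (fC3) $M_{qi}=M_{rj}=N$ (an $N$-symbol; so $q=r$), $i=j$, $\alpha\,\mathscr H\,\beta$ and $\partial(\alpha,\beta)\in N$; - (fC4) $M_{qi}=M_{rj}=\mu^\downarrow$, $\widehat\alpha=\widehat\beta$ and $\alpha\,\mathscr L\,\beta$; - (fC5) $M_{qi}=M_{rj}=\mu^\uparrow$, $\widehat\alpha=\widehat\beta$ and $\alpha\,\mathscr R\,\beta$; - (fC6) $M_{qi}=M_{rj}=\mu$, $\widehat\alpha=\widehat\beta$, and either $(q,i)=(r,j)$ or $i-j=\min_q(M)-\min_r(M)$; together with (fC7) the pairs $((i,\alpha),\mathbf 0)$ and $(\mathbf 0,(i,\alpha))$ with $M_{qi}=R$ where $q=\operatorname{rank}\alpha$, and (fC8) the pair $(\mathbf 0,\mathbf 0)$. **The ordering $\le_C$.** On entries: $\Delta$ is the least and $R$ the greatest element; $\mu^\uparrow<\mu$ and $\mu^\downarrow<\mu$, with $\mu^\uparrow,\mu^\downarrow$ incomparable; for $N$-symbols,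 $N\le_C N'$ iff both are normal subgroups of the same $\mathcal S_q$ and $N\le N'$; $N$-symbols are incomparable with $\mu^\uparrow,\mu^\downarrow,\mu$. fC-matrices are ordered entrywise.
   Formalization: For n = 1 it is assumed that the entries ζ of M^1 and M^2 (where both have type fRT2 or fRT3) are the same symbol: P_1 has one rank-1 element, so different ζ give equal cg(M), and the claim fails, e.g. for d = 0, M_00 = R, M_10 = μ versus Δ. *)

(* Defs.v *)
From HB Require Import structures.
From mathcomp Require Import all_boot all_order all_fingroup all_algebra.

Set Implicit Arguments.
Unset Strict Implicit.
Unset Printing Implicit Defensive.

(* Partitions of X u X', where X = {1, ..., n} is indexed by 'I_n.
   [inl x] is the upper vertex x, [inr x] the lower vertex x'. *)

Definition vertex (n : nat) : finType := ('I_n + 'I_n)%type.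

Definition ptn (n : nat) : finType :=
  {P : {set {set vertex n}} | partition P [set: vertex n]}.

Definition upper n : {set vertex n} := [set inl x | x : 'I_n].
Definition lower n : {set vertex n} := [set inr x | x : 'I_n].

(* The product graph lives on X u X'' u X', encoded as
   [inl (inl x)] = x, [inl (inr x)] = x'', [inr x] = x'. *)

Definition vertex3 (n : nat) : finType := ('I_n + 'I_n + 'I_n)%type.

Definition emb_left n (v : vertex n) : vertex3 n :=
  match v with inl x => inl (inl x) | inr x => inl (inr x) end.
Definition emb_right n (v : vertex n) : vertex3 n :=
  match v with inl x => inl (inr x) | inr x => inr x end.
Definition emb_outer n (v : vertex n) : vertex3 n :=
  match v with inl x => inl (inl x) | inr x => inr x end.
Definition middle n : {set vertex3 n} := [set inl (inr x) | x : 'I_n].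

(* Each partition is represented by the graph whose components are the
   complete graphs on its blocks. *)
Definition prod_graph n (a b : ptn n) : rel (vertex3 n) := fun u v =>
  [exists B in val a,
     (u \in [set emb_left x | x in B]) && (v \in [set emb_left x | x in B])]
  || [exists B in val b,
     (u \in [set emb_right x | x in B]) && (v \in [set emb_right x | x in B])].

Lemma prod_graph_sym n (a b : ptn n) : symmetric (prod_graph a b).
Proof.
by move=> u v; rewrite /prod_graph; congr (_ || _);
  apply: eq_existsb => B; congr (_ && _); rewrite andbC.
Qed.

Lemma prod_graph_equiv n (a b : ptn n) :
  equivalence_rel (connect (prod_graph a b)).
Proof.
have sym := @sym_connect_sym _ _ (@prod_graph_sym n a b).
split=> [|/[dup] xy]; first exact: connect0.
by move=> /(same_connect sym) ->.
Qed.

Definition pmul_blocks n (a b : ptn n) : {set {set vertex n}} :=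
  equivalence_partition
    (fun x y => connect (prod_graph a b) (emb_outer x) (emb_outer y))
    [set: vertex n].

Lemma pmul_subproof n (a b : ptn n) :
  partition (pmul_blocks a b) [set: vertex n].
Proof.
by apply: equivalence_partitionP => x y z _ _ _; apply: prod_graph_equiv.
Qed.

Definition pmul n (a b : ptn n) : ptn n := Sub (pmul_blocks a b) (pmul_subproof a b).

Definition Phi n (a b : ptn n) : nat :=
  #|[set C in equivalence_partition (connect (prod_graph a b)) [set: vertex3 n]
       | C \subset middle n]|.

Definition transversals n (a : ptn n) : {set {set vertex n}} :=
  [set B in val a | (B :&: upper n != set0) && (B :&: lower n != set0)].

Definition rank n (a : ptn n) : nat := #|transversals a|.

Lemma rank_le n (a : ptn n) : rank a < n.+1.
Proof.
rewrite ltnS /rank; set T := transversals a.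
have sel B : B \in T -> exists x : 'I_n, inl x \in B.
  rewrite inE => /and3P[_ /set0Pn[v /setIP[vB /imsetP[x _ ev]]] _].
  by exists x; rewrite -ev.
have [P /and3P[_ tP _]] := (val a, valP a).
pose f (B : {set vertex n}) := [pick x : 'I_n | inl x \in B].
have fT B : B \in T -> exists2 x, f B = Some x & inl x \in B.
  move=> BT; rewrite /f; case: pickP => [x xB|no]; first by exists x.
  by have [x] := sel _ BT; rewrite no.
have finj : {in T &, injective f}.
  move=> B C BT CT; have [x -> xB] := fT B BT; have [y -> yC] := fT C CT.
  move=> [exy]; move: yC; rewrite -exy => xC.
  move: BT CT; rewrite !inE => /andP[Ba _] /andP[Ca _].
  by rewrite -(def_pblock tP Ba xB) (def_pblock tP Ca xC).
have sub : [set f B | B in T] \subset [set Some x | x : 'I_n].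
  apply/subsetP=> _ /imsetP[B BT ->]; have [x -> _] := fT B BT.
  exact: imset_f.
rewrite -(card_in_imset finj); apply: leq_trans (subset_leq_card sub) _.
by apply: leq_trans (leq_imset_card _ _) _; rewrite card_ord.
Qed.

Definition rk n (a : ptn n) : 'I_n.+1 := Ordinal (rank_le a).

Definition hat_blocks n (a : ptn n) : {set {set vertex n}} :=
  (val a :\: transversals a)
  :|: [set B :&: upper n | B in transversals a]
  :|: [set B :&: lower n | B in transversals a].

Lemma hat_subproof n (a : ptn n) : partition (hat_blocks a) [set: vertex n].
Proof.
have /and3P[/eqP cP tP P0] := valP a.
pose half (v : vertex n) := if v is inl _ then upper n else lower n.
have inU v : (v \in upper n) = (if v is inl _ then true else false).
  by case: v => x; [apply/imsetP; exists x | apply/imsetP; case].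
have inL v : (v \in lower n) = (if v is inr _ then true else false).
  by case: v => x; [apply/imsetP; case | apply/imsetP; exists x].
pose F v := let B := pblock (val a) v in
  if B \in transversals a then B :&: half v else B.
have TP B : B \in transversals a -> B \in val a by rewrite inE => /andP[].
have hatF C v : C \in hat_blocks a -> v \in C -> C = F v.
  rewrite /hat_blocks /F => /setUP[/setUP[/setDP[Ca CT]|]|].
  - by move=> vC; rewrite (def_pblock tP Ca vC) (negPf CT).
  - case/imsetP=> B BT -> /setIP[vB]; rewrite inU => vU.
    by rewrite (def_pblock tP (TP _ BT) vB) BT /half; case: v vU {vB}.
  - case/imsetP=> B BT -> /setIP[vB]; rewrite inL => vL.
    by rewrite (def_pblock tP (TP _ BT) vB) BT /half; case: v vL {vB}.
have vcov v : v \in cover (val a) by rewrite cP inE.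
apply/and3P; split.
- apply/eqP/setP=> v; rewrite inE; apply/bigcupP.
  have vB : v \in pblock (val a) v by rewrite mem_pblock.
  have Ba := pblock_mem (vcov v).
  case BT: (pblock (val a) v \in transversals a); last first.
    by exists (pblock (val a) v) => //; rewrite /hat_blocks !in_setU in_setD BT Ba.
  case: v vB Ba BT => x vB Ba BT.
    exists (pblock (val a) (inl x) :&: upper n); last by rewrite inE vB inU.
    by rewrite /hat_blocks !in_setU (imset_f (fun B => B :&: upper n)) ?orbT.
  exists (pblock (val a) (inr x) :&: lower n); last by rewrite inE vB inL.
  by rewrite /hat_blocks !in_setU (imset_f (fun B => B :&: lower n)) ?orbT.
- apply/trivIsetP=> C D Ch Dh; apply: contraR => /pred0Pn[v /andP[vC vD]].
  by apply/eqP; rewrite (hatF _ _ Ch vC) (hatF _ _ Dh vD).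
- rewrite /hat_blocks !in_setU !negb_or -andbA; apply/and3P; split.
  + by rewrite in_setD (negPf P0) andbF.
  + by apply/imsetP=> -[B]; rewrite inE => /and3P[_ + _] e; rewrite -e eqxx.
  + by apply/imsetP=> -[B]; rewrite inE => /and3P[_ _ +] e; rewrite -e eqxx.
Qed.

Definition hat n (a : ptn n) : ptn n := Sub (hat_blocks a) (hat_subproof a).

(* The partition monoid has an identity, so that S^1 = S in the usual
   definition of Green's relations. *)
Definition greenR n (a b : ptn n) : bool :=
  [set pmul a c | c : ptn n] == [set pmul b c | c : ptn n].
Definition greenL n (a b : ptn n) : bool :=
  [set pmul c a | c : ptn n] == [set pmul c b | c : ptn n].
Definition greenH n (a b : ptn n) : bool := greenR a b && greenL a b.

Definition join_block n (A B : {set 'I_n}) : {set vertex n} :=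
  [set inl x | x in A] :|: [set inr y | y in B].

(* [partial_perm a b p] states that p is a value of \partial(a, b): for some
   enumeration A_i u B_i' of the transversals of a, those of b are the
   A_i u B_{ip}'. The value depends on the enumeration, which replaces p by a
   conjugate in 'S_q, so that membership in a normal subgroup does not. *)
Definition partial_perm n q (a b : ptn n) (p : 'S_q) : Prop :=
  exists A B : 'I_q -> {set 'I_n},
    [/\ injective (fun i => join_block (A i) (B i)),
        transversals a = [set join_block (A i) (B i) | i : 'I_q] &
        transversals b = [set join_block (A i) (B (p i)) | i : 'I_q]].

(* The d-twisted partition monoid; [None] is the zero element. *)
Definition twisted (n d : nat) : finType := option ('I_d.+1 * ptn n).

Definition tmul n d (x y : twisted n d) : twisted n d :=
  if x is Some (i, a) then
    if y is Some (j, b) then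
      if insub (i + j + Phi a b) is Some k then Some (k, pmul a b) else None
    else None
  else None.

Inductive symbol : Type :=
  | Delta | MuUp | MuDown | Mu | RR | NSym q of {group 'S_q}.

Definition symbol_code (s : symbol) : nat + {q : nat & {group 'S_q}} :=
  match s with
  | Delta => inl 0 | MuUp => inl 1 | MuDown => inl 2 | Mu => inl 3 | RR => inl 4
  | NSym q N => inr (Tagged (fun q => {group 'S_q}) N)
  end.
Definition symbol_decode (c : nat + {q : nat & {group 'S_q}}) : symbol :=
  match c with
  | inl 0 => Delta | inl 1 => MuUp | inl 2 => MuDown | inl 3 => Mu | inl _ => RR
  | inr N => NSym (tagged N)
  end.
Lemma symbol_codeK : cancel symbol_code symbol_decode.
Proof. by case. Qed.
HB.instance Definition _ := Equality.copy symbol (can_type symbol_codeK).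

Definition is_NSym (s : symbol) : bool := if s is NSym _ _ then true else false.

Definition nontrivial_normal q (N : {group 'S_q}) : bool :=
  (N <| [set: 'S_q])%g && (N :!=: 1%g).

Definition fC_entry (n : nat) (s : symbol) : bool :=
  if s is NSym q N then (2 <= q <= n) && nontrivial_normal N else true.

Inductive le_symbol : symbol -> symbol -> Prop :=
  | le_symbol_refl s : le_symbol s s
  | le_symbol_Delta s : le_symbol Delta s
  | le_symbol_R s : le_symbol s RR
  | le_symbol_MuUp : le_symbol MuUp Mu
  | le_symbol_MuDown : le_symbol MuDown Mu
  | le_symbol_N q (N N' : {group 'S_q}) :
      N \subset N' -> le_symbol (NSym N) (NSym N').

Definition zetas : seq symbol := [:: Mu; MuUp; MuDown; Delta].

Definition row0 (n : nat) : 'I_n.+1 := ord0.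
(* Meaningful only when 0 < n. *)
Definition row1 (n : nat) : 'I_n.+1 := inord 1.

Section FCMatrix.

Variables n d : nat.
Implicit Types (M : 'M[symbol]_(n.+1, d.+1)) (q : 'I_n.+1) (z : symbol).

Definition fRT1 M : bool :=
  [exists k : 'I_d.+2, forall j : 'I_d.+1,
    (M (row0 n) j == if j < k then Delta else RR) &&
    (M (row1 n) j == if j < k then Delta else RR)].

Definition fRT2_at z M : bool :=
  [exists i : 'I_d.+1, exists k : 'I_d.+1, (i < k) &&
    [forall j : 'I_d.+1,
      (M (row0 n) j == if j < i then Delta else if j < k then Mu else RR) &&
      (M (row1 n) j == if j < i then Delta else if j == i then z
                 else if j <= k then Mu else RR)]].
Definition fRT2 M : bool := has (fRT2_at ^~ M) zetas.

Definition fRT3_at z M : bool :=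
  [exists k : 'I_d.+2, exists l : 'I_d.+2, (k < l) &&
    [forall j : 'I_d.+1,
      (M (row0 n) j == if j < k then Delta else RR) &&
      (M (row1 n) j == if j < l.-1 then Delta else if j == l.-1 :> nat then z
                 else RR)]].
Definition fRT3 M : bool := has (fRT3_at ^~ M) zetas.

Definition fRT4 M : bool :=
  [exists k : 'I_d.+2, exists l : 'I_d.+2, (0 < k < l.-1) &&
    [forall j : 'I_d.+1,
      (M (row0 n) j == if j < k.-1 then Delta else if j == k.-1 :> nat then Mu
                 else RR) &&
      (M (row1 n) j == if j < l.-1 then Delta else if j == l.-1 :> nat then Mu
                 else RR)]].

Definition fRT5 M q : bool :=
  [exists i : 'I_d.+2, exists k : 'I_d.+2, (i <= k) &&
    [exists N : {ffun 'I_d.+1 -> {group 'S_q}},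
      [&& [forall j : 'I_d.+1, (i <= j < k) ==> nontrivial_normal (N j)],
          [forall j : 'I_d.+1, forall j' : 'I_d.+1,
             (i <= j <= j') && (j' < k) ==> (N j \subset N j')] &
          [forall j : 'I_d.+1,
             M q j == if j < i then Delta else if j < k then NSym (N j)
                      else RR]]]].

Definition fC_V1 M : bool :=
  [forall q : 'I_n.+1, forall q' : 'I_n.+1, forall i : 'I_d.+1,
    (q == q'.+1 :> nat) && is_NSym (M q i) ==>
      (M q' i \notin [:: Delta; MuUp; MuDown]) && ~~ is_NSym (M q' i)].

Definition fC_V2 M : bool :=
  [forall q : 'I_n.+1, forall q' : 'I_n.+1, forall i : 'I_d.+1,
    [&& 2 <= q, q == q'.+1 :> nat & M q i == RR] ==> (M q' i == RR)].

Definition fC_matrix M : bool :=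
  [&& [forall q, forall i, fC_entry n (M q i)],
      [|| fRT1 M, fRT2 M, fRT3 M | fRT4 M],
      [forall q : 'I_n.+1, (2 <= q) ==> fRT5 M q],
      fC_V1 M & fC_V2 M].

(* [zeta_is z M]: if M has type fRT2 or fRT3, then the entry \zeta is z.
   For n = 1, where 1 is the only element of rank 1, the four choices of \zeta
   give the same relation cg(M) and cannot be told apart by it. *)
Definition zeta_is z M : bool :=
  [|| fRT1 M, fRT2_at z M, fRT3_at z M | fRT4 M].

(* [find] returns the size d + 1 of the row if there is no such entry. *)
Definition minR M q : nat := find (fun i => M q i == RR) (enum 'I_d.+1).
Definition min0 M : nat := minR M (row0 n).
Definition min1 M : nat := minR M (row1 n).

(* These are meaningful only for matrices of type fRT2 or fRT4. *)
Definition muin0 M : nat :=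
  if fRT2 M then find (fun i => M (row0 n) i == Mu) (enum 'I_d.+1) else (min0 M).-1.
Definition muin1 M : nat :=
  if fRT2 M then (muin0 M).+1 else (min1 M).-1.

Inductive cg M : twisted n d -> twisted n d -> Prop :=
  | cg_fC1 i j a b : M (rk a) i = Delta -> M (rk b) j = Delta ->
      i = j -> a = b -> cg M (Some (i, a)) (Some (j, b))
  | cg_fC2 i j a b : M (rk a) i = RR -> M (rk b) j = RR ->
      cg M (Some (i, a)) (Some (j, b))
  | cg_fC3 i j a b q (N : {group 'S_q}) :
      M (rk a) i = NSym N -> M (rk b) j = NSym N ->
      i = j -> greenH a b -> (exists2 p : 'S_q, partial_perm a b p & p \in N) ->
      cg M (Some (i, a)) (Some (j, b))
  | cg_fC4 i j a b : M (rk a) i = MuDown -> M (rk b) j = MuDown ->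
      hat a = hat b -> greenL a b -> cg M (Some (i, a)) (Some (j, b))
  | cg_fC5 i j a b : M (rk a) i = MuUp -> M (rk b) j = MuUp ->
      hat a = hat b -> greenR a b -> cg M (Some (i, a)) (Some (j, b))
  | cg_fC6 i j a b : M (rk a) i = Mu -> M (rk b) j = Mu ->
      hat a = hat b ->
      (rk a, i) = (rk b, j) \/
        (i%:Z - j%:Z = (minR M (rk a))%:Z - (minR M (rk b))%:Z)%R ->
      cg M (Some (i, a)) (Some (j, b))
  | cg_fC7_left i a : M (rk a) i = RR -> cg M (Some (i, a)) None
  | cg_fC7_right i a : M (rk a) i = RR -> cg M None (Some (i, a))
  | cg_fC8 : cg M None None.

Definition le_fC M1 M2 : Prop := forall q i, le_symbol (M1 q i) (M2 q i).

End FCMatrix.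

(* Main.v *)
Require Import Defs.
From HB Require Import structures.
From mathcomp Require Import all_boot all_order all_fingroup all_algebra.
From mathcomp Require Import zify.

(** Membership of a pair in cg(M) is decided by the matrix cells of its two
    elements: the cells must carry the same symbol, and the symbol says which
    condition on the partitions is imposed ([cg_cell]).  Hence an inclusion of
    relations can be read off cell by cell, provided that there are enough
    partitions to tell the symbols apart, and provided that one deals with the
    only pairs that link two different cells not labelled R, namely those
    between a mu of row 0 and a mu of row 1.

    Witnesses.  All test partitions have transversals {w k, (v k)'} for two
    injections w, v, all other blocks being singletons ([pbij w v]).
    Permuting the upper (lower) vertices of a partition keeps its L-class
    (R-class), because the middle vertices of every product can be permuted
    accordingly; this gives all the Green relations that are needed.  In rank
    q >= 2 the pairs ([pbij w w], [pbij w (w \o p)]) are H-related with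
    permutation p, so they recover p up to conjugacy ([inclusion_ge2]).  In
    rank 1 the partitions [edge i j], with transversal {i, j'}, are R-related
    iff they share i and L-related iff they share j, and they all have the same
    hat; as soon as n > 1 they separate Delta, the two arrows and mu
    ([inclusion_zeta_n_gt1]).

    Rows 0 and 1.  The admissible types are all of the form: Delta, then mu,
    then R in row 0; Delta, then at most one exceptional entry zeta, then mu,
    then R in row 1.  They are described by the breakpoints u0, m0 of row 0
    and s, u1, m1 of row 1 ([rows_shape]).  In all types m1 - u1 = m0 - u0, so
    the translation by m1 - m0 matches the mu entries of row 0 with those of
    row 1 in columns u1 <= j < m1, and matched cells are the ones
    linked by cg(M).  A linked pair of M1 must be sent to a pair of R's or to a
    pair of linked mu's of M2 ([inclusion_linked]); the second case forces the
    two matrices to have the same translation.  Applied to the first mu of row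
    0 this is condition (b); applied to the others it gives M1 <= M2 on the mu
    entries.  Conversely, (a) and (b) say that linked pairs are sent to linked
    pairs or to pairs of R's ([le_linked]), and all other pairs of cg(M1) lie
    within one cell or come from R's, where (a) suffices ([le_inclusion]).

    When n = 1 there is a single partition of rank 1 and the zeta entry is
    invisible in its own cell.  Its position is nevertheless determined by the
    neighbouring cells, since zeta sits just before the first R or the first
    linked mu of row 1, and so the comparison of the zeta entries follows when
    both matrices use the same value of zeta ([inclusion_zeta_n_eq1]). *)

Set Implicit Arguments.
Unset Strict Implicit.
Unset Printing Implicit Defensive.

(** * Partitions as equivalence relations, and products *)

Section SameBlock.
Variable n : nat.
Implicit Types (a b c : ptn n) (x y : vertex n).

Lemma ptn_cover a x : x \in cover (val a).
Proof. by have /and3P[/eqP-> _ _] := valP a; rewrite inE. Qed.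

Lemma ptn_triv a : trivIset (val a).
Proof. by have /and3P[] := valP a. Qed.

Lemma mem_pblock_self a x : x \in pblock (val a) x.
Proof. by rewrite mem_pblock ptn_cover. Qed.

Lemma ptn_blocks a : val a = [set pblock (val a) x | x : vertex n].
Proof.
apply/setP=> B; apply/idP/imsetP=> [Ba|[x _ ->]]; last first.
  by rewrite pblock_mem ?ptn_cover.
have /set0Pn[x xB]: B != set0.
  by apply: contraTneq Ba => ->; have /and3P[] := valP a.
by exists x => //; rewrite (def_pblock (ptn_triv a) Ba xB).
Qed.

Lemma ptn_ext a b :
  (forall x y, (y \in pblock (val a) x) = (y \in pblock (val b) x)) -> a = b.
Proof.
move=> eqab; apply: val_inj; rewrite (ptn_blocks a) (ptn_blocks b).
by apply: eq_imset => x; apply/setP=> y.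
Qed.

Lemma pblock_pmul a b x y :
  (y \in pblock (val (pmul a b)) x) =
  connect (prod_graph a b) (emb_outer x) (emb_outer y).
Proof.
rewrite pblock_equivalence_partition ?inE // => u v w _ _ _.
exact: prod_graph_equiv.
Qed.

Lemma prod_graphP a b u v :
  reflect ((exists x y, [/\ u = emb_left x, v = emb_left y
                          & y \in pblock (val a) x]) \/
           (exists x y, [/\ u = emb_right x, v = emb_right y
                          & y \in pblock (val b) x]))
          (prod_graph a b u v).
Proof.
apply: (iffP orP) => -[].
- case/existsP=> B /and3P[Ba /imsetP[x xB ->] /imsetP[y yB ->]].
  by left; exists x, y; rewrite (def_pblock (ptn_triv a) Ba xB).
- case/existsP=> B /and3P[Bb /imsetP[x xB ->] /imsetP[y yB ->]].
  by right; exists x, y; rewrite (def_pblock (ptn_triv b) Bb xB).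
- case=> x [y [-> -> yx]]; left; apply/existsP; exists (pblock (val a) x).
  by rewrite pblock_mem ?ptn_cover ?imset_f ?mem_pblock_self.
- case=> x [y [-> -> yx]]; right; apply/existsP; exists (pblock (val b) x).
  by rewrite pblock_mem ?ptn_cover ?imset_f ?mem_pblock_self.
Qed.

Lemma ptn_of_subproof (T : eqType) (f : vertex n -> T) :
  partition (preim_partition f [set: vertex n]) [set: vertex n].
Proof. exact: preim_partitionP. Qed.

Definition fibres (T : eqType) (f : vertex n -> T) : ptn n :=
  Sub (preim_partition f [set: vertex n]) (ptn_of_subproof f).

Lemma pblock_fibres (T : eqType) (f : vertex n -> T) x y :
  (y \in pblock (val (fibres f)) x) = (f x == f y).
Proof.
rewrite pblock_equivalence_partition ?inE // => u v w _ _ _ /=.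
by split=> // /eqP->.
Qed.

(** The blocks are the preimages of those of a under f: for a permutation f,
    they are the images under its inverse. *)
Definition relabel (f : vertex n -> vertex n) a := fibres (pblock (val a) \o f).

Lemma pblock_relabel f a x y :
  (y \in pblock (val (relabel f a)) x) = (f y \in pblock (val a) (f x)).
Proof.
by rewrite pblock_fibres /= eq_pblock ?ptn_triv ?ptn_cover.
Qed.

End SameBlock.

(** * Permuting vertices, and Green's relations *)

Section Relabelling.
Variable n : nat.
Implicit Types (a b c : ptn n) (s : 'S_n).

Definition on_upper s (x : vertex n) : vertex n :=
  match x with inl i => inl (s i) | inr j => inr j end.
Definition on_lower s (x : vertex n) : vertex n :=
  match x with inl i => inl i | inr j => inr (s j) end.
Definition on_middle s (x : vertex3 n) : vertex3 n :=
  match x with inl (inr i) => inl (inr (s i)) | _ => x end.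

Lemma on_upperK s : cancel (on_upper s) (on_upper s^-1%g).
Proof. by case=> i //=; rewrite permK. Qed.

Lemma on_lowerK s : cancel (on_lower s) (on_lower s^-1%g).
Proof. by case=> i //=; rewrite permK. Qed.

Lemma on_upperKV s : cancel (on_upper s^-1%g) (on_upper s).
Proof. by case=> i //=; rewrite permKV. Qed.

Lemma on_lowerKV s : cancel (on_lower s^-1%g) (on_lower s).
Proof. by case=> i //=; rewrite permKV. Qed.

Lemma relabelK f g a : cancel g f -> relabel g (relabel f a) = a.
Proof. by move=> fK; apply: ptn_ext => x y; rewrite !pblock_relabel !fK. Qed.

Lemma connect_relabel s a b u v :
  connect (prod_graph (relabel (on_lower s) a) (relabel (on_upper s) b)) u v ->
  connect (prod_graph a b) (on_middle s u) (on_middle s v).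
Proof.
case/connectP=> p; elim: p u => [|w p IHp] u /=; first by move=> _ ->.
case/andP=> uw wp vE; apply: connect_trans (IHp w wp vE); apply: connect1.
apply/prod_graphP; case/prod_graphP: uw => -[x [y [-> -> yx]]].
  left; exists (on_lower s x), (on_lower s y).
  by rewrite -pblock_relabel; split=> //; [case: (x)|case: (y)].
right; exists (on_upper s x), (on_upper s y).
by rewrite -pblock_relabel; split=> //; [case: (x)|case: (y)].
Qed.

(** Moving s across the product: the middle vertices are erased, so it does
    not matter how they are named. *)
Lemma pmul_relabel s a b :
  pmul (relabel (on_lower s) a) (relabel (on_upper s) b) = pmul a b.
Proof.
have outer t (x : vertex n) : on_middle t (emb_outer x) = emb_outer x.
  by case: x.
apply: ptn_ext => x y; rewrite !pblock_pmul; apply/idP/idP=> xy.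
  by have := connect_relabel xy; rewrite !outer.
rewrite -(outer s^-1%g x) -(outer s^-1%g y); apply: connect_relabel.
by rewrite !relabelK //; [apply: on_upperKV | apply: on_lowerKV].
Qed.

(** The factor c in [pmul c a] can absorb s on its lower vertices, which is a
    bijection on the factors. *)
Lemma greenL_relabel s a : greenL a (relabel (on_upper s) a).
Proof.
apply/eqP/setP=> b; apply/imsetP/imsetP=> -[c _ ->].
  by exists (relabel (on_lower s) c); rewrite ?pmul_relabel.
exists (relabel (on_lower s^-1%g) c) => //.
by rewrite -[RHS](pmul_relabel s) relabelK //; apply: on_lowerK.
Qed.

Lemma greenR_relabel s a : greenR a (relabel (on_lower s) a).
Proof.
apply/eqP/setP=> b; apply/imsetP/imsetP=> -[c _ ->].
  by exists (relabel (on_upper s) c); rewrite ?pmul_relabel.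
exists (relabel (on_upper s^-1%g) c) => //.
by rewrite -[RHS](pmul_relabel s) relabelK //; apply: on_upperK.
Qed.

End Relabelling.

(** * Partitions given by partial bijections *)

Section PartialBijections.
Variables n q : nat.
Implicit Types (w v : 'I_q -> 'I_n) (s : 'S_n) (x y : vertex n) (p : 'S_q).

(** Sends each vertex to a representative of its block: the lower end of a
    transversal is moved to its upper end, other vertices stay. *)
Definition glue w v x : vertex n :=
  if x is inr j then
    if [pick k | v k == j] is Some k then inl (w k) else x
  else x.

Definition pbij w v : ptn n := fibres (glue w v).

Lemma relabel_upper_pbij w v s :
  relabel (on_upper s) (pbij w v) = pbij (s^-1%g \o w) v.
Proof.
apply: ptn_ext => x y; rewrite pblock_relabel !pblock_fibres.
have gE z : glue (s^-1%g \o w) v z = on_upper s^-1%g (glue w v (on_upper s z)).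
  by case: z => i /=; [rewrite permK | case: pickP].
by rewrite !gE (can_eq (on_upperK s^-1%g)).
Qed.

Lemma relabel_lower_pbij w v s :
  relabel (on_lower s) (pbij w v) = pbij w (s^-1%g \o v).
Proof.
apply: ptn_ext => x y; rewrite pblock_relabel !pblock_fibres.
have gE z : glue w (s^-1%g \o v) z = on_lower s^-1%g (glue w v (on_lower s z)).
  case: z => i //=; rewrite (eq_pick (Q := fun k => v k == s i)).
    by case: pickP => //= _; rewrite permK.
  by move=> k; rewrite /= (canF_eq (permKV s)).
by rewrite !gE (can_eq (on_lowerK s^-1%g)).
Qed.

(** Only the matching of w with v counts, not the order in which it is listed;
    this turns a permutation of the lower ends into one of the upper ends. *)
Lemma pbij_reindex w v p : injective v -> pbij (w \o p) (v \o p) = pbij w v.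
Proof.
move=> v_inj; apply: ptn_ext => x y; rewrite !pblock_fibres.
have gE z : glue (w \o p) (v \o p) z = glue w v z.
  case: z => j //=; case: pickP => [k /eqP <-|no].
    case: pickP => [l /eqP/v_inj-> //|/(_ (p k))]; first by rewrite eqxx.
  case: pickP => // k /eqP vk.
  by have := no (p^-1%g k); rewrite /= permKV vk eqxx.
by rewrite !gE.
Qed.

Lemma in_join_blockl (A B : {set 'I_n}) i :
  (inl i \in join_block A B) = (i \in A).
Proof.
rewrite inE (mem_imset _ _ inl_inj); case: imsetP => [[]//|_]; exact: orbF.
Qed.

Lemma in_join_blockr (A B : {set 'I_n}) j :
  (inr j \in join_block A B) = (j \in B).
Proof. by rewrite inE (mem_imset _ _ inr_inj); case: imsetP => [[]|]. Qed.

Definition in_join_block := (in_join_blockl, in_join_blockr).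

Lemma join_block_inj (A B A' B' : {set 'I_n}) :
  join_block A B = join_block A' B' -> A = A' /\ B = B'.
Proof.
by move=> e; split; apply/setP=> i;
  [rewrite -!(in_join_blockl _ B) | rewrite -!(in_join_blockr A)];
  rewrite e ?in_join_block.
Qed.

Lemma in_upper x : (x \in upper n) = (if x is inl _ then true else false).
Proof. by case: x => i; [rewrite imset_f | apply/imsetP=> -[]]. Qed.

Lemma in_lower x : (x \in lower n) = (if x is inr _ then true else false).
Proof. by case: x => i; [apply/imsetP=> -[] | rewrite imset_f]. Qed.

Lemma pblock_pbij_transversal w v k : injective w -> injective v ->
  pblock (val (pbij w v)) (inl (w k)) = join_block [set w k] [set v k].
Proof.
move=> w_inj v_inj; apply/setP=> y; rewrite pblock_fibres.
case: y => j; rewrite in_join_block inE [glue _ _ (inl _)]/= eq_sym.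
  by rewrite (inj_eq inl_inj).
rewrite /glue; case: pickP => [l /eqP <-|/(_ k)].
  by rewrite (inj_eq inl_inj) (inj_eq w_inj) (inj_eq v_inj).
by rewrite eq_sym => ->.
Qed.

Lemma pblock_pbij_singleton w v x :
  (forall k, x \notin join_block [set w k] [set v k]) ->
  pblock (val (pbij w v)) x = [set x].
Proof.
move=> xN; apply/setP=> y; rewrite pblock_fibres inE eq_sym.
have -> : glue w v x = x.
  case: x xN => //= j jN; case: pickP => // k /eqP vk.
  by have := jN k; rewrite in_join_block vk inE eqxx.
case: y => //= j; case: pickP => // k /eqP vk.
have -> : (inr j == x) = false.
  by apply: contraTF (xN k) => /eqP <-; rewrite negbK in_join_block vk inE.
by apply: contraTF (xN k) => /eqP <-; rewrite negbK in_join_block inE.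
Qed.

Lemma transversals_pbij w v : injective w -> injective v ->
  transversals (pbij w v) =
  [set join_block [set w k] [set v k] | k : 'I_q].
Proof.
move=> w_inj v_inj; apply/setP=> B; rewrite inE.
apply/andP/imsetP=> [[Bp BT]|[k _ ->]]; last first.
  rewrite -(pblock_pbij_transversal k w_inj v_inj) pblock_mem ?ptn_cover //.
  rewrite pblock_pbij_transversal //; split=> //; apply/andP; split.
    apply/set0Pn; exists (inl (w k)).
    by rewrite inE in_join_block set11 imset_f.
  apply/set0Pn; exists (inr (v k)).
  by rewrite inE in_join_block set11 imset_f.
move: Bp BT; rewrite ptn_blocks => /imsetP[x _ ->] {B}.
case: (pickP (fun k => x \in join_block [set w k] [set v k])) => [k xk _|no].
  exists k => //; rewrite -pblock_pbij_transversal // in xk *.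
  exact: same_pblock (ptn_triv _) xk.
rewrite pblock_pbij_singleton => [|k]; last by rewrite no.
case/andP=> /set0Pn[y /setIP[/set1P-> /imsetP[i _ ->]]].
by case/set0Pn=> z /setIP[/set1P-> /imsetP[]].
Qed.

Lemma rank_pbij w v : injective w -> injective v -> rank (pbij w v) = q.
Proof.
move=> w_inj v_inj; rewrite /rank transversals_pbij // card_imset ?card_ord //.
by move=> k l /join_block_inj[/set1_inj/w_inj].
Qed.

(** All blocks left after splitting are singletons, so the hat is the discrete
    partition whatever w, v and q are. *)
Lemma hat_pbij w v : injective w -> injective v ->
  hat (pbij w v) = fibres id.
Proof.
move=> w_inj v_inj.
have sing B : B \in val (hat (pbij w v)) -> exists x, B = [set x].
  rewrite /= /hat_blocks !in_setU in_setD -orbA => /or3P[/andP[BT]||].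
  - rewrite ptn_blocks => /imsetP[x _ BE]; exists x.
    rewrite BE; apply: pblock_pbij_singleton => k.
    apply: contraNN BT => xk; rewrite transversals_pbij // BE.
    apply/imsetP; exists k => //; rewrite -pblock_pbij_transversal // in xk *.
    exact: same_pblock (ptn_triv _) xk.
  - rewrite transversals_pbij // => /imsetP[_ /imsetP[k _ ->] ->].
    exists (inl (w k)); apply/setP=> -[] i;
      by rewrite in_setI in_upper ?andbT ?andbF in_set1
                 ?in_join_blockl ?in_set1.
  - rewrite transversals_pbij // => /imsetP[_ /imsetP[k _ ->] ->].
    exists (inr (v k)); apply/setP=> -[] i;
      by rewrite in_setI in_lower ?andbT ?andbF in_set1
                 ?in_join_blockr ?in_set1.
apply: ptn_ext => x y; rewrite pblock_fibres /= eq_sym.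
have [z zE] := sing _ (pblock_mem (ptn_cover (hat (pbij w v)) x)).
have := mem_pblock_self (hat (pbij w v)) x.
by rewrite zE !inE => /eqP->.
Qed.

Lemma greenL_pbij w v s : greenL (pbij w v) (pbij (s \o w) v).
Proof.
by have := greenL_relabel s^-1%g (pbij w v); rewrite relabel_upper_pbij invgK.
Qed.

Lemma greenR_pbij w v s : greenR (pbij w v) (pbij w (s \o v)).
Proof.
by have := greenR_relabel s^-1%g (pbij w v); rewrite relabel_lower_pbij invgK.
Qed.

(** The extension is the identity outside the range of w. *)
Lemma perm_extension w p : injective w ->
  exists s : 'S_n, forall k, s (w k) = w (p k).
Proof.
move=> w_inj.
pose f i := if [pick k | w k == i] is Some k then w (p k) else i.
have fw k : f (w k) = w (p k).
  rewrite /f; case: pickP => [l /eqP/w_inj-> //|/(_ k)]; by rewrite eqxx.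
have fN i : (forall k, w k != i) -> f i = i.
  by move=> no; rewrite /f; case: pickP => // k; rewrite (negPf (no k)).
have f_inj : injective f.
  move=> i j; case: (pickP (fun k => w k == i)) => [k /eqP <-|noi];
  case: (pickP (fun k => w k == j)) => [l /eqP <-|noj].
  - by rewrite !fw => /w_inj/perm_inj->.
  - rewrite fw fN => [e|m]; last by rewrite noj.
    by have := noj (p k); rewrite e eqxx.
  - rewrite fw fN => [e|m]; last by rewrite noi.
    by have := noi (p l); rewrite -e eqxx.
  - by rewrite !fN // => m; rewrite ?noi ?noj.
by exists (perm f_inj) => k; rewrite permE fw.
Qed.

Lemma eq_pbij w w' v v' : w =1 w' -> v =1 v' -> pbij w v = pbij w' v'.
Proof.
move=> ew ev; apply: ptn_ext => x y; rewrite !pblock_fibres.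
have gE z : glue w v z = glue w' v' z.
  case: z => //= j; rewrite (eq_pick (Q := fun k => v' k == j)).
    by case: pickP => // k _; rewrite ew.
  by move=> k; rewrite /= ev.
by rewrite !gE.
Qed.

Lemma greenH_pbij w p : injective w -> greenH (pbij w w) (pbij w (w \o p)).
Proof.
move=> w_inj; apply/andP; split.
  have [s sE] := perm_extension p w_inj.
  have ->: pbij w (w \o p) = pbij w (s \o w) by apply: eq_pbij => // k /=.
  exact: greenR_pbij.
have [s sE] := perm_extension p^-1%g w_inj.
have ->: pbij w (w \o p) = pbij (s \o w) w.
  rewrite -(pbij_reindex (s \o w) p) //; apply: eq_pbij => // k.
  by rewrite /= sE permK.
exact: greenL_pbij.
Qed.

Lemma partial_perm_pbij w p : injective w ->
  partial_perm (pbij w w) (pbij w (w \o p)) p.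
Proof.
move=> w_inj; exists (fun k => [set w k]), (fun k => [set w k]); split.
- by move=> k l /join_block_inj[/set1_inj/w_inj].
- by rewrite transversals_pbij.
- by rewrite transversals_pbij //; apply: inj_comp w_inj perm_inj.
Qed.

(** Two enumerations of the transversals of [pbij w w] differ by a permutation
    of the indices, which conjugates the permutation that is read off. *)
Lemma partial_perm_pbij_conj w p p' : injective w ->
  partial_perm (pbij w w) (pbij w (w \o p)) p' ->
  exists s : 'S_q, p' = (p ^ s)%g.
Proof.
move=> w_inj [A [B [AB_inj]]]; rewrite !transversals_pbij //; last first.
  exact: inj_comp w_inj perm_inj.
move=> eA eB.
have exs k : exists l, join_block (A k) (B k) == join_block [set w l] [set w l].
  have: join_block (A k) (B k) \in [set join_block (A i) (B i) | i : 'I_q].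
    exact: imset_f.
  by rewrite -eA => /imsetP[l _ ->]; exists l.
pose f k := xchoose (exs k).
have fE k : A k = [set w (f k)] /\ B k = [set w (f k)].
  by have /eqP/join_block_inj := xchooseP (exs k).
have f_inj : injective f.
  move=> k l e; apply: AB_inj.
  by have [-> ->] := fE k; have [-> ->] := fE l; rewrite e.
exists (perm f_inj)^-1%g; apply/permP=> k.
have: join_block (A k) (B (p' k)) \in
      [set join_block (A i) (B (p' i)) | i : 'I_q].
  exact: imset_f.
rewrite -eB => /imsetP[l _ /join_block_inj[]].
have [-> _] := fE k; have [_ ->] := fE (p' k).
move=> /set1_inj/w_inj <- /set1_inj/w_inj e.
have {}e : perm f_inj (p' k) = p (perm f_inj k) by rewrite !permE.
by rewrite conjgE invgK !permM -e permK.
Qed.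
End PartialBijections.

(** * Partitions of rank one, and self-related pairs *)

Section Rank.
Variable n : nat.
Implicit Types a b c : ptn n.

(** Listing the transversals in any order shows that a is related to itself by
    the identity permutation. *)
Lemma partial_perm_id a : partial_perm a a (1 : 'S_(rank a))%g.
Proof.
pose T (k : 'I_(rank a)) : {set vertex n} := enum_val (A := transversals a) k.
pose A (k : 'I_(rank a)) := [set i | inl i \in T k].
pose B (k : 'I_(rank a)) := [set j | inr j \in T k].
have TE k : join_block (A k) (B k) = T k.
  by apply/setP=> -[] i; rewrite in_join_block inE.
have TT : transversals a = [set join_block (A i) (B i) | i : 'I_(rank a)].
  apply/setP=> C; apply/idP/imsetP=> [CT|[k _ ->]]; last first.
    by rewrite TE enum_valP.
  by exists (enum_rank_in CT C); rewrite // TE /T enum_rankK_in.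
exists A, B; split=> //.
  by move=> k l; rewrite !TE => /enum_val_inj.
by rewrite {1}TT; apply: eq_imset => k; rewrite perm1.
Qed.

Lemma greenR_refl a : greenR a a. Proof. exact: eqxx. Qed.
Lemma greenL_refl a : greenL a a. Proof. exact: eqxx. Qed.

(** No edge of the product graph leaves a vertex that is a singleton block of
    the left factor. *)
Lemma pmul_isolated_upper a b x :
  (forall y, y \in pblock (val a) (inl x) -> y = inl x) ->
  forall y, y \in pblock (val (pmul a b)) (inl x) -> y = inl x.
Proof.
move=> iso y; rewrite pblock_pmul => xy.
have cl : closed (prod_graph a b) (pred1 (inl (inl x) : vertex3 n)).
  apply: intro_closed; first exact: sym_connect_sym (@prod_graph_sym _ a b).
  move=> u v /prod_graphP[] [s [t [-> -> ts]]] /eqP; last by case: s ts.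
  by case: s ts => // s ts [e]; move: ts; rewrite e => /iso->; rewrite inE.
have := closed_connect cl xy; rewrite !inE /= eqxx.
by case: y {xy} => // j /esym/eqP[->].
Qed.

Lemma pmul_isolated_lower a b x :
  (forall y, y \in pblock (val b) (inr x) -> y = inr x) ->
  forall y, y \in pblock (val (pmul a b)) (inr x) -> y = inr x.
Proof.
move=> iso y; rewrite pblock_pmul => xy.
have cl : closed (prod_graph a b) (pred1 (inr x : vertex3 n)).
  apply: intro_closed; first exact: sym_connect_sym (@prod_graph_sym _ a b).
  move=> u v /prod_graphP[] [s [t [-> -> ts]]] /eqP; first by case: s ts.
  by case: s ts => // s ts [e]; move: ts; rewrite e => /iso->; rewrite inE.
have := closed_connect cl xy; rewrite !inE /= eqxx.
by case: y {xy} => // j /esym/eqP[->].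
Qed.

Definition edge (i j : 'I_n) : ptn n :=
  pbij (fun _ : 'I_1 => i) (fun _ : 'I_1 => j).

Lemma const1_inj (i : 'I_n) : injective (fun _ : 'I_1 => i).
Proof. by move=> k l _; rewrite !ord1. Qed.

Lemma pblock_edge i j x y : (y \in pblock (val (edge i j)) x) =
  (x == y) || (x \in [:: inl i; inr j]) && (y \in [:: inl i; inr j]).
Proof.
rewrite pblock_fibres.
have gE z : glue (fun _ : 'I_1 => i) (fun _ : 'I_1 => j) z = 
   if z == inr j then inl i else z.
  case: z => //= k; rewrite (inj_eq inr_inj) eq_sym.
  by case: pickP => [_ ->|/(_ ord0) ->].
rewrite !gE !inE; have [->|xj] := eqVneq x (inr j);
  have [->|yj] := eqVneq y (inr j);
  rewrite ?orbT ?orbF ?eqxx ?andbT //=.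
  by rewrite (negPf xj).
by have [-> /=|] := eqVneq x (inl i); rewrite ?orbF // (eq_sym y) orbb.
Qed.

(** Multiplying [edge i j] by [edge j j] keeps i in a transversal, while i stays
    a singleton in every right multiple of [edge k l] if k differs from i. *)
Lemma greenR_edge i j k l : greenR (edge i j) (edge k l) -> i = k.
Proof.
move=> /eqP eR.
have: pmul (edge i j) (edge j j) \in [set pmul (edge i j) c | c : ptn n].
  exact: imset_f.
rewrite eR => /imsetP[c _ e]; apply/eqP; apply: contraT => ik.
have iso y : y \in pblock (val (edge k l)) (inl i) -> y = inl i.
  rewrite pblock_edge => /orP[/eqP-> // | /andP[]].
  by rewrite !inE => /orP[] /eqP // -[eik]; rewrite eik eqxx in ik.
have := pmul_isolated_upper iso (b := c) (y := inr j).
rewrite -e pblock_pmul /= => H.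
suff /H: connect (prod_graph (edge i j) (edge j j)) (inl (inl i)) (inr j) by [].
apply: (@connect_trans _ _ (inl (inr j))); apply: connect1.
  by apply/prod_graphP; left; exists (inl i), (inr j);
    rewrite pblock_edge !inE !eqxx.
by apply/prod_graphP; right; exists (inl j), (inr j);
  rewrite pblock_edge !inE !eqxx.
Qed.

Lemma greenL_edge i j k l : greenL (edge i j) (edge k l) -> j = l.
Proof.
move=> /eqP eL.
have: pmul (edge i i) (edge i j) \in [set pmul c (edge i j) | c : ptn n].
  exact: imset_f.
rewrite eL => /imsetP[c _ e]; apply/eqP; apply: contraT => jl.
have iso y : y \in pblock (val (edge k l)) (inr j) -> y = inr j.
  rewrite pblock_edge => /orP[/eqP-> // | /andP[]].
  by rewrite !inE => /orP[] /eqP // -[ejl]; rewrite ejl eqxx in jl.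
have := pmul_isolated_lower iso (a := c) (y := inl i).
rewrite -e pblock_pmul /= => H.
suff /H: connect (prod_graph (edge i i) (edge i j)) (inr j) (inl (inl i)) by [].
rewrite (sym_connect_sym (@prod_graph_sym _ _ _)).
apply: (@connect_trans _ _ (inl (inr i))); apply: connect1.
  by apply/prod_graphP; left; exists (inl i), (inr i);
    rewrite pblock_edge !inE !eqxx.
by apply/prod_graphP; right; exists (inl i), (inr j);
  rewrite pblock_edge !inE !eqxx.
Qed.

Lemma edge_greenL i j k : greenL (edge i j) (edge k j).
Proof.
have ->: edge k j = pbij (tperm i k \o fun _ : 'I_1 => i) (fun=> j).
  by apply: eq_pbij => // l /=; rewrite tpermL.
exact: greenL_pbij.
Qed.

Lemma edge_greenR i j k : greenR (edge i j) (edge i k).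
Proof.
have ->: edge i k = pbij (fun=> i) (tperm j k \o fun _ : 'I_1 => j).
  by apply: eq_pbij => // l /=; rewrite tpermL.
exact: greenR_pbij.
Qed.
End Rank.

(** * The shape of rows 0 and 1 *)

Local Notation row0 := Defs.row0.
Local Notation row1 := Defs.row1.

Section Rows.
Variables n d : nat.
Implicit Types (M : 'M[symbol]_(n.+1, d.+1)) (z : symbol).

(** For k = d + 1 the last hypothesis is vacuous, and k is the value that [find]
    returns when nothing is found. *)
Lemma find_ord (P : pred 'I_d.+1) k : k <= d.+1 ->
  (forall j : 'I_d.+1, j < k -> ~~ P j) ->
  (forall j : 'I_d.+1, j = k :> nat -> P j) ->
  find P (enum 'I_d.+1) = k.
Proof.
move=> kd before at_k.
pose Q j := P (inord j).
rewrite (eq_find (a2 := preim val Q)) => [|j]; last by rewrite /Q /= inord_val.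
rewrite -find_map val_enum_ord -(subnKC kd) iotaD find_cat size_iota add0n.
have -> : has Q (iota 0 k) = false.
  apply/hasPn=> j; rewrite mem_iota /= add0n => jk.
  by apply: before; rewrite inordK // (leq_trans jk).
case e: (d.+1 - k) => [|m] /=; first by rewrite addn0.
have kd' : k < d.+1 by rewrite -subn_gt0 e.
by rewrite /Q at_k ?addn0 // inordK.
Qed.

(** The four admissible configurations of breakpoints.  [ProfileFlat]: two equal
    rows without mu or zeta.  [ProfileMuAdjacent]: a run of mu in row 0 and the
    same run, shifted by one, in row 1, preceded by zeta.  [ProfileZeta]: no
    linked mu, and zeta just before the first R of row 1.  [ProfileMuFar]: a
    single mu in each row, at distance at least two.  The interval [s, u1) is
    either empty or the single position of zeta, and m1 - u1 = m0 - u0 in all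
    cases. *)
Variant profile (u0 m0 s u1 m1 : nat) : Prop :=
| ProfileFlat of u0 = m0 & s = m0 & u1 = m0 & m1 = m0
| ProfileMuAdjacent of s = u0 & u1 = u0.+1 & m1 = m0.+1 & u0 < m0
| ProfileZeta of u0 = m0 & u1 = s.+1 & m1 = s.+1 & m0 <= s
| ProfileMuFar of m0 = u0.+1 & u1 = s & m1 = s.+1 & m0 < s.

Definition rows_shape M z (u0 m0 s u1 m1 : nat) : Prop :=
  [/\ forall j, M (row0 n) j =
        if j < u0 then Delta else if j < m0 then Mu else RR,
      forall j, M (row1 n) j =
        if j < s then Delta else if j < u1 then z
        else if j < m1 then Mu else RR,
      m1 <= d.+1 & profile u0 m0 s u1 m1].

Lemma rows_shape_exists M z : zeta_is z M ->
  exists u0 m0 s u1 m1, rows_shape M z u0 m0 s u1 m1.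
Proof.
case/or4P=> /existsP[i].
- move=> /forallP H; exists i, i, i, i, i.
  split=> [j|j||]; last exact: ProfileFlat.
  + by have /andP[/eqP-> _] := H j; case: ltnP.
  + by have /andP[_ /eqP->] := H j; case: ltnP.
  + by rewrite -ltnS.
- case/existsP=> k /andP[ik /forallP H].
  exists i, k, i, i.+1, k.+1; split=> // [j|j|]; last exact: ProfileMuAdjacent.
    by have /andP[/eqP-> _] := H j.
  have /andP[_ /eqP->] := H j; rewrite ltnS -val_eqE /=.
  by case: ltngtP.
- case/existsP=> l /andP[kl /forallP H].
  have l0 : l.-1.+1 = l by rewrite prednK //; lia.
  exists i, i, l.-1, l, l; split=> // [j|j||]; last by apply: ProfileZeta; lia.
  + by have /andP[/eqP-> _] := H j; case: ltnP.
  + have /andP[_ /eqP->] := H j.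
    have ->: (j < l) = (j <= l.-1) by lia.
    by case: ltngtP.
  + by rewrite -ltnS.
case/existsP=> l /andP[/andP[i0 il] /forallP H].
have l0 : l.-1.+1 = l by rewrite prednK //; lia.
have i1 : i.-1.+1 = i by rewrite prednK.
exists i.-1, i, l.-1, l.-1, l.
split=> // [j|j||]; last by apply: ProfileMuFar; lia.
+ have /andP[/eqP-> _] := H j.
  have ->: (j < i) = (j <= i.-1) by lia.
  by case: ltngtP.
+ have /andP[_ /eqP->] := H j.
  have ->: (j < l) = (j <= l.-1) by lia.
    by case: ltngtP.
+ by rewrite -ltnS.
Qed.

Lemma fC_zeta M : fC_matrix M -> exists2 z, z \in zetas & zeta_is z M.
Proof.
case/and5P=> _ types _ _ _; case/or4P: types => H.
- by exists Mu; rewrite // /zeta_is H.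
- by case/hasP: H => z zz H; exists z; rewrite // /zeta_is H orbT.
- by case/hasP: H => z zz H; exists z; rewrite // /zeta_is H !orbT.
- by exists Mu; rewrite // /zeta_is H !orbT.
Qed.

Section Shape.
Variables (M : 'M[symbol]_(n.+1, d.+1)) (z : symbol) (u0 m0 s u1 m1 : nat).
Hypothesis shM : rows_shape M z u0 m0 s u1 m1.

Lemma shape_R0 i : M (row0 n) i = RR <-> m0 <= i.
Proof.
case: shM => -> _ _ prof; split; first by do 2!(case: ltnP => //).
by move=> mi; rewrite !ifF //; case: prof; lia.
Qed.

Lemma shape_R1 i : z \in zetas -> M (row1 n) i = RR <-> m1 <= i.
Proof.
case: shM => _ -> _ prof zz; split; last first.
  by move=> mi; rewrite !ifF //; case: prof; lia.
case: ltnP => // _; case: ltnP => [_ zR|_]; last by case: ltnP.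
by case/negP: zz; rewrite zR.
Qed.

Lemma shape_min0 : min0 M = m0.
Proof.
case: shM => row0E _ m1d prof; apply: find_ord.
- by case: prof; lia.
- by move=> j jm; rewrite row0E jm; case: ifP.
- by move=> j jm; rewrite row0E jm ltnn; case: prof => *; rewrite ifF //; lia.
Qed.

Lemma shape_min1 : z \in zetas -> min1 M = m1.
Proof.
move=> zz; have zR : z != RR by apply: contraTneq zz => ->.
case: shM => _ row1E m1d prof; apply: find_ord => //.
- by move=> j jm; rewrite row1E jm; do 2!case: ifP => // _.
- move=> j jm; rewrite row1E jm ltnn; case: prof => *;
  by rewrite !ifF //; lia.
Qed.

(** The two types with mu in row 0 are told apart by row 1 in the column just
    after such a mu: it has a mu there in this type, and a Delta in [fRT4]. *)
Lemma fRT2_Mu N : fRT2 N -> exists i j : 'I_d.+1,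
  [/\ j = i.+1 :> nat, N (row0 n) i = Mu & N (row1 n) j = Mu].
Proof.
case/hasP=> y _ /existsP[i /existsP[k /andP[ik /forallP H]]].
have id1 : i.+1 < d.+1 by rewrite (leq_ltn_trans ik).
exists i, (Ordinal id1); split=> //.
  by have /andP[/eqP-> _] := H i; rewrite ltnn ik.
have /andP[_ /eqP->] := H (Ordinal id1).
by rewrite -val_eqE /= ltnNge leqnSn /= gtn_eqF // ik.
Qed.

Lemma fRT4_Mu N : fRT4 N -> exists i j : 'I_d.+1,
  [/\ j = i.+1 :> nat, N (row0 n) i = Mu & N (row1 n) j = Delta].
Proof.
case/existsP=> k /existsP[l /andP[/andP[k0 kl] /forallP H]].
have ld := ltn_ord l; have k1 : k.-1.+1 = k by rewrite prednK.
have kd : k.-1 < d.+1 by lia.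
have kd1 : k < d.+1 by lia.
exists (Ordinal kd), (Ordinal kd1); rewrite /= k1; split=> //.
  by have /andP[/eqP-> _] := H (Ordinal kd); rewrite /= ltnn eqxx.
by have /andP[_ /eqP->] := H (Ordinal kd1); rewrite /= kl.
Qed.

Lemma shape_Mu0 i : M (row0 n) i = Mu -> u0 <= i < m0.
Proof. by case: shM => -> _ _ _; do 2!case: ltnP. Qed.

Lemma shape_mu_lt : (fRT2 M \/ fRT4 M) -> u0 < m0.
Proof.
case=> [/fRT2_Mu[i [j [_ H _]]] | /fRT4_Mu[i [j [_ H _]]]].
  by have := shape_Mu0 H; lia.
by have := shape_Mu0 H; lia.
Qed.

Lemma shape_mu_types : fC_matrix M -> u0 < m0 -> fRT2 M \/ fRT4 M.
Proof.
case/and5P=> _ types _ _ _ um.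
have md : u0 < d.+1 by case: shM => _ _ ? []; lia.
have Mu_u0 : M (row0 n) (Ordinal md) = Mu.
  by case: shM => -> _ _ _; rewrite /= ltnn um.
case/or4P: types; try by [left | right].
- case/existsP=> k /forallP/(_ (Ordinal md))/andP[].
  by rewrite Mu_u0; case: ifP.
- case/hasP=> y _ /existsP[k /existsP[l /andP[_ /forallP/(_ (Ordinal md))]]].
  by case/andP; rewrite Mu_u0; case: ifP.
Qed.

Lemma shape_muin : z \in zetas -> (fRT2 M \/ fRT4 M) ->
  muin0 M = u0 /\ muin1 M = u1.
Proof.
move=> zz mu; have um := shape_mu_lt mu.
have md : u0 < d.+1 by case: shM => _ _ ? []; lia.
rewrite /muin1 /muin0 shape_min0 shape_min1 //.
have findE : find (fun i => M (row0 n) i == Mu) (enum 'I_d.+1) = u0.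
  case: shM => row0E _ _ _; apply: find_ord; first exact: ltnW.
    by move=> j ju; rewrite row0E ju.
  by move=> j ju; rewrite row0E ju ltnn um.
case: ifP => [M2|nM2].
  rewrite findE; split=> //.
  have [i [j [ji /shape_Mu0 iu Mj]]] := fRT2_Mu M2.
  case: shM => _ row1E _ []; try lia.
  move=> m0E u1E m1E ms; move: Mj; rewrite row1E; case: ltnP => //; lia.
case: mu => [|M4]; first by rewrite nM2.
have [i [j [ji /shape_Mu0 iu Mj]]] := fRT4_Mu M4.
case: shM => _ row1E _ [] //; try lia.
move=> sE u1E m1E ms; move: Mj; rewrite row1E.
by do 3!case: ltnP => //; lia.
Qed.
End Shape.
End Rows.

(** * Reading the relation cell by cell *)

Section Cells.
Variables n d : nat.
Implicit Types (M : 'M[symbol]_(n.+1, d.+1)).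

Lemma fC_row_ge2 M (q : 'I_n.+1) i : fC_matrix M -> 2 <= q ->
  [\/ M q i = Delta, M q i = RR
    | exists2 N : {group 'S_q}, nontrivial_normal N & M q i = NSym N].
Proof.
case/and5P=> _ _ /forallP/(_ q)/implyP rows _ _ /rows.
case/existsP=> k /existsP[l /andP[_ /existsP[N /and3P[/forallP Nn _]]]].
move=> /forallP/(_ i)/eqP->; case: ltnP => ki; first exact: Or31.
case: ltnP => il; last exact: Or32.
by apply: Or33; exists (N i) => //; have := Nn i; rewrite ki il.
Qed.

Lemma le_symbolP s t : le_symbol s t -> t = RR \/
  match s with
  | Delta => True
  | MuUp => t = MuUp \/ t = Mu
  | MuDown => t = MuDown \/ t = Mu
  | Mu => t = Mu
  | RR => False
  | NSym q N => exists2 N' : {group 'S_q}, N \subset N' & t = NSym N'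
  end.
Proof.
case=> [[]|||||q N N' sN]; try by [left | right | right; left | right; right].
  by move=> q N; right; exists N.
by right; exists N'.
Qed.

(** The symbols of the two cells agree and determine the clause; a group symbol
    of an fC-matrix has degree at most n, which is what clause (fC3) needs. *)
Lemma cg_cell M i j (a b : ptn n) : fC_matrix M ->
  cg M (Some (i, a)) (Some (j, b)) <->
  M (rk b) j = M (rk a) i /\
  match M (rk a) i with
  | Delta => i = j /\ a = b
  | MuUp => hat a = hat b /\ greenR a b
  | MuDown => hat a = hat b /\ greenL a b
  | Mu => hat a = hat b /\
      ((rk a, i) = (rk b, j) \/
       (i%:Z - j%:Z = (minR M (rk a))%:Z - (minR M (rk b))%:Z)%R)
  | RR => True
  | NSym q N => [/\ i = j, greenH a b &
      exists2 p : 'S_q, partial_perm a b p & p \in N]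
  end.
Proof.
move=> fM; split.
  move=> H; inversion H as [i' j' a' b' E E'|i' j' a' b' E E'|
    i' j' a' b' q N E E'|i' j' a' b' E E'|i' j' a' b' E E'|
    i' j' a' b' E E'| | | ];
  by rewrite E E'.
case; case E: (M (rk a) i) => [| | | | |q N] E'.
- by case; apply: cg_fC1.
- by case; apply: cg_fC5.
- by case; apply: cg_fC4.
- by case; apply: cg_fC6.
- by move=> _; apply: cg_fC2.
- move: (fM) => /andP[/forallP/(_ (rk a))/forallP/(_ i)] + _.
  rewrite E => /andP[/andP[_]]; rewrite -ltnS => qn _ [ij ab pp].
  exact: (@cg_fC3 _ _ _ _ _ _ _ (Ordinal qn) N).
Qed.

Lemma row_injection (q : 'I_n.+1) : exists w : 'I_q -> 'I_n, injective w.
Proof.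
have qn : q <= n by rewrite -ltnS.
by exists (widen_ord qn) => k l /(congr1 val)/= e; apply: val_inj.
Qed.

Lemma rk_pbij (q : 'I_n.+1) (w v : 'I_q -> 'I_n) : injective w -> injective v ->
  rk (pbij w v) = q.
Proof. by move=> wi vi; apply: val_inj; rewrite /= rank_pbij. Qed.

Lemma rk_edge (x y : 'I_n) : rk (edge x y) = row1 n.
Proof.
apply: val_inj; rewrite /= inordK; last by have := ltn_ord x; lia.
by rewrite rank_pbij //; apply: const1_inj.
Qed.

Lemma hat_edge (x y : 'I_n) : hat (edge x y) = fibres id.
Proof. by rewrite hat_pbij //; apply: const1_inj. Qed.

End Cells.

(** * Comparing two matrices *)

Section Comparison.
Variables (n d : nat) (M1 M2 : 'M[symbol]_(n.+1, d.+1)).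
Hypotheses (n_gt0 : 0 < n) (fM1 : fC_matrix M1) (fM2 : fC_matrix M2).

Section Forward.
Hypothesis sub12 : forall x y : twisted n d, cg M1 x y -> cg M2 x y.

(** R is the only symbol that relates an element to zero. *)
Lemma inclusion_R q i : M1 q i = RR -> M2 q i = RR.
Proof.
have [w wi] := row_injection q; rewrite -(rk_pbij wi wi) => E.
have := sub12 (cg_fC7_left E) => H; by inversion H.
Qed.

(** The pairs of [pairs] are non-trivial if p is, which excludes Delta, and
    they detect every p in N up to conjugacy, which is enough because the other
    group is normal. *)
Lemma inclusion_ge2 (q : 'I_n.+1) i : 2 <= q -> le_symbol (M1 q i) (M2 q i).
Proof.
move=> q2; have [E|E|[N Nn E]] := fC_row_ge2 i fM1 q2.
- by rewrite E; apply: le_symbol_Delta.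
- by rewrite (inclusion_R E); apply: le_symbol_R.
have [w wi] := row_injection q.
have wpi (p : 'S_q) : injective (w \o p) by apply: inj_comp wi perm_inj.
have pairs p : p \in N ->
    cg M2 (Some (i, pbij w w)) (Some (i, pbij w (w \o p))).
  move=> pN; apply: sub12; apply/(cg_cell _ _ _ _ fM1).
  rewrite !rk_pbij // E; split=> //; split=> //; first exact: greenH_pbij.
  by exists p => //; apply: partial_perm_pbij.
have [E2|E2|[N' /andP[/andP[_ /subsetP nN'] _] E2]] := fC_row_ge2 i fM2 q2.
- have /andP[_ /trivgPn[p pN p1]] := Nn.
  have /(cg_cell _ _ _ _ fM2) := pairs p pN.
  rewrite !rk_pbij // E2 => -[_ [_ ab]].
  have id1 : pbij w (w \o (1 : 'S_q)%g) = pbij w w.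
    by apply: eq_pbij => // k; rewrite /= perm1.
  have := partial_perm_pbij 1%g wi; rewrite id1 {2}ab.
  case/(partial_perm_pbij_conj wi)=> s /esym/eqP.
  by rewrite conjg_eq1 (negPf p1).
- by rewrite E2; apply: le_symbol_R.
rewrite E E2; apply: le_symbol_N; apply/subsetP=> p pN.
have /(cg_cell _ _ _ _ fM2) := pairs p pN.
rewrite !rk_pbij // E2 => -[_ [_ _ [p']]].
case/(partial_perm_pbij_conj wi)=> s ->; rewrite memJ_norm //.
by apply: nN'; rewrite inE.
Qed.


Lemma row_cases (q : 'I_n.+1) : [\/ q = row0 n, q = row1 n | 2 <= q].
Proof.
case: (ltngtP q 1) => q1; last 2 first.
- exact: Or33.
- by apply: Or32; apply: val_inj; rewrite /= inordK.
by apply: Or31; apply: val_inj => /=; lia.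
Qed.

Section Shapes.
Variables (z1 z2 : symbol) (u0 m0 s u1 m1 u0' m0' s' u1' m1' : nat).
Hypotheses (zz1 : z1 \in zetas) (zz2 : z2 \in zetas).
Hypotheses (sh1 : rows_shape M1 z1 u0 m0 s u1 m1)
           (sh2 : rows_shape M2 z2 u0' m0' s' u1' m1').

(** The pair formed by the discrete partition in cell (0, i) and a partition of
    rank 1 in cell (1, j) lies in cg(M1); in cg(M2) only (fC2) and the second
    alternative of (fC6) relate partitions of different ranks. *)
Lemma inclusion_linked (i j : 'I_d.+1) :
  M1 (row0 n) i = Mu -> i + m1 = j + m0 ->
  (M2 (row0 n) i = RR /\ M2 (row1 n) j = RR) \/
  [/\ M2 (row0 n) i = Mu, M2 (row1 n) j = Mu & m1 + m0' = m0 + m1'].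
Proof.
move=> Mi ij; have iu := shape_Mu0 sh1 Mi.
have Mj : M1 (row1 n) j = Mu.
  by case: sh1 => _ -> _ prof; do 3!case: ltnP => //; case: prof; lia.
have [w wi] := row_injection (row0 n).
pose x : 'I_n := Ordinal n_gt0.
have e12 : cg M1 (Some (i, pbij w w)) (Some (j, edge x x)).
  apply/(cg_cell _ _ _ _ fM1).
  rewrite rk_pbij // rk_edge Mi Mj hat_edge hat_pbij //.
  split=> //; split=> //; right.
  rewrite -/(min0 M1) -/(min1 M1) (shape_min0 sh1) (shape_min1 sh1 zz1); lia.
have /(cg_cell _ _ _ _ fM2) := sub12 e12.
rewrite rk_pbij // rk_edge => -[->].
have [row0E _ _ _] := sh2; rewrite row0E.
case: ltnP => _.
  case=> _ e; have /eqP : rk (edge x x) = rk (pbij w w) by rewrite e.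
  by rewrite rk_edge rk_pbij // -val_eqE /= inordK.
case: ltnP => _; last by left.
case=> _ [/(congr1 fst)/eqP|]; first by rewrite -val_eqE /= inordK.
rewrite -/(min0 M2) -/(min1 M2) (shape_min0 sh2) (shape_min1 sh2 zz2) => e.
by right; split=> //; lia.
Qed.

Lemma inclusion_row0 i : le_symbol (M1 (row0 n) i) (M2 (row0 n) i).
Proof.
have [row0E _ m1d prof] := sh1.
case E: (M1 (row0 n) i) => [| | | | |q N].
- exact: le_symbol_Delta.
- by move: E; rewrite row0E; case: ltnP => // _; case: ltnP.
- by move: E; rewrite row0E; case: ltnP => // _; case: ltnP.
- have iu := shape_Mu0 sh1 E.
  have jd : i + m1 - m0 < d.+1 by case: prof; lia.
  have ij : i + m1 = Ordinal jd + m0 by move=> /=; case: prof; lia.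
  by have [[-> _]|[-> _ _]] := inclusion_linked E ij; constructor.
- by rewrite (inclusion_R E); apply: le_symbol_refl.
- by move: E; rewrite row0E; case: ltnP => // _; case: ltnP.
Qed.

(** Every mu of row 1 in this range is linked to a mu of row 0. *)
Lemma inclusion_row1_Mu (j : 'I_d.+1) : u1 <= j < m1 ->
  le_symbol Mu (M2 (row1 n) j).
Proof.
have [row0E _ m1d prof] := sh1 => ju.
have id : j + m0 - m1 < d.+1 by case: prof; lia.
have ij : Ordinal id + m1 = j + m0 by move=> /=; case: prof; lia.
have Mi : M1 (row0 n) (Ordinal id) = Mu.
  by rewrite row0E /=; do 2!case: ltnP => //; case: prof; lia.
by have [[_ ->]|[_ -> _]] := inclusion_linked Mi ij; constructor.
Qed.

(** Each arrow is tested on two edges sharing one end, and mu on two disjoint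
    edges, which are neither R-related nor L-related. *)
Lemma inclusion_zeta_n_gt1 (i : 'I_d.+1) : 1 < n -> M1 (row1 n) i = z1 ->
  le_symbol z1 (M2 (row1 n) i).
Proof.
move=> n1 Mi.
pose x : 'I_n := Ordinal n_gt0; pose y : 'I_n := Ordinal n1.
have xy : x <> y by [].
have out a b a' b' : cg M1 (Some (i, edge a b)) (Some (i, edge a' b')) ->
  match M2 (row1 n) i with
  | Delta => a = a' /\ b = b'
  | MuUp => a = a'
  | MuDown => b = b'
  | NSym q N => False
  | _ => True
  end.
  move/sub12/(cg_cell _ _ _ _ fM2); rewrite !rk_edge => -[_].
  case E: (M2 (row1 n) i) => [| | | | |q N] //.
  - case=> _ e; split.
      by apply: (@greenR_edge _ _ b _ b'); rewrite e; apply: greenR_refl.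
    by apply: (@greenL_edge _ a _ a'); rewrite e; apply: greenL_refl.
  - by case=> _ /greenR_edge.
  - by case=> _ /greenL_edge.
  have [_ row1E _ _] := sh2; move: E; rewrite row1E.
  case: ltnP => // _; case: ltnP => [_|_]; last by case: ltnP.
  by move: zz2; case: z2.
move: zz1 Mi; case: z1 => // _ Mi.
- exact: le_symbol_Delta.
- have /out : cg M1 (Some (i, edge x x)) (Some (i, edge x y)).
    apply/(cg_cell _ _ _ _ fM1); rewrite !rk_edge Mi !hat_edge.
    by split=> //; split=> //; apply: edge_greenR.
  by case: (M2 _ _) => [[_ /xy]|_|/xy|_|_|] //; constructor.
- have /out : cg M1 (Some (i, edge x x)) (Some (i, edge y x)).
    apply/(cg_cell _ _ _ _ fM1); rewrite !rk_edge Mi !hat_edge.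
    by split=> //; split=> //; apply: edge_greenL.
  by case: (M2 _ _) => [[/xy]|/xy|_|_|_|] //; constructor.
have /out : cg M1 (Some (i, edge x x)) (Some (i, edge y y)).
  apply/(cg_cell _ _ _ _ fM1); rewrite !rk_edge Mi !hat_edge.
  by split=> //; split=> //; left.
by case: (M2 _ _) => [[/xy]|/xy|/xy|_|_|] //; constructor.
Qed.

(** Since all entries of row 1 from column s' on are zeta, mu or R, it suffices
    that s' <= s.  In M1 the cell (1, s + 1) is R, outside the matrix, or a mu
    linked to (0, s); the image of this information in M2 bounds s'. *)
Lemma inclusion_zeta_n_eq1 (i : 'I_d.+1) : z1 = z2 -> s < u1 -> i = s :> nat ->
  le_symbol z1 (M2 (row1 n) i).
Proof.
move=> zE su is_s.
have [_ _ m1d prof] := sh1; have [_ row1E' m1d' prof'] := sh2.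
have z1_Mu : le_symbol z1 Mu by case: z1 zz1 => // _; constructor.
suff s's : s' <= s.
  rewrite row1E' is_s ltnNge s's /= -zE.
  by case: ifP => _; [constructor | case: ifP => _ //; constructor].
case: prof => [|sE u1E m1E um|_ u1E m1E ms|]; try lia.
  have s1d : s.+1 < d.+1 by lia.
  have Mi : M1 (row0 n) i = Mu.
    by case: sh1 => -> _ _ _; do 2!case: ltnP => //; lia.
  have ij : i + m1 = Ordinal s1d + m0 by move=> /=; lia.
  have := inclusion_linked Mi ij.
  case=> [[/(shape_R0 sh2) m0's /(shape_R1 sh2 _ zz2)/= m1's]|].
    by case: prof'; lia.
  case=> /(shape_Mu0 sh2) u0's _ m1'E; by case: prof'; lia.
have m0's : m0' <= s.
  by rewrite -is_s; apply/(shape_R0 sh2); apply/inclusion_R/(shape_R0 sh1); lia.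
have m1's : m1' <= s.+1.
  have [s1d|] := ltnP s.+1 d.+1; last lia.
  apply/(shape_R1 sh2 (Ordinal s1d) zz2).
  by apply/inclusion_R/(shape_R1 sh1 _ zz1) => /=; lia.
by case: prof'; lia.
Qed.

Lemma inclusion_row1 i : (n = 1 -> z1 = z2) ->
  le_symbol (M1 (row1 n) i) (M2 (row1 n) i).
Proof.
move=> zE; have [_ row1E m1d prof] := sh1; have Mi := row1E i.
move: Mi; case: ltnP => [_ ->|si]; first exact: le_symbol_Delta.
case: ltnP => [iu Mi|ui]; last case: ltnP => [im ->|mi Mi].
- rewrite {1}Mi; have [n1|] := ltnP 1 n; first exact: inclusion_zeta_n_gt1.
  move=> n1; apply: inclusion_zeta_n_eq1; first by apply: zE; lia.
    exact: leq_ltn_trans iu.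
  by case: prof; lia.
- by apply: inclusion_row1_Mu; rewrite ui.
by rewrite (inclusion_R Mi); apply: le_symbol_R.
Qed.

Lemma inclusion_le : (n = 1 -> z1 = z2) -> le_fC M1 M2.
Proof.
move=> zE q i; case: (row_cases q) => [->|->|q2].
- exact: inclusion_row0.
- exact: inclusion_row1.
- exact: inclusion_ge2.
Qed.

Lemma inclusion_muin : fRT2 M1 \/ fRT4 M1 ->
  (min0 M2 <= muin0 M1 /\ min1 M2 <= muin1 M1) \/
  ((fRT2 M2 \/ fRT4 M2) /\
   ((min1 M2)%:Z - (min0 M2)%:Z = (min1 M1)%:Z - (min0 M1)%:Z)%R).
Proof.
move=> mu; have um := shape_mu_lt sh1 mu; have [-> ->] := shape_muin sh1 zz1 mu.
rewrite !(shape_min0 sh1, shape_min0 sh2).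
rewrite !(shape_min1 sh1 zz1, shape_min1 sh2 zz2).
have [_ _ m1d prof] := sh1.
(* The leftmost linked pair consists of the cells (0, u0) and (1, u1). *)
have u0d : u0 < d.+1 by case: prof; lia.
have u1d : u1 < d.+1 by case: prof; lia.
have Mi : M1 (row0 n) (Ordinal u0d) = Mu.
  by case: sh1 => -> _ _ _; rewrite /= ltnn um.
have ij : Ordinal u0d + m1 = Ordinal u1d + m0 by move=> /=; case: prof; lia.
case: (inclusion_linked Mi ij).
  by case=> /(shape_R0 sh2) ? /(shape_R1 sh2 _ zz2) ?; left.
case=> /(shape_Mu0 sh2) u0'i _ m1'E; right; split; last lia.
by apply: (shape_mu_types sh2 fM2); lia.
Qed.

End Shapes.
End Forward.

Lemma row01_symbol (M : 'M[symbol]_(n.+1, d.+1)) (q : 'I_n.+1) i :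
  fC_matrix M -> q < 2 -> ~~ is_NSym (M q i).
Proof.
move=> fM q2; have [z zz /rows_shape_exists] := fC_zeta fM.
move=> [u0 [m0 [s [u1 [m1 [row0E row1E _ _]]]]]].
have [->|->|] := row_cases q; last lia.
  by rewrite row0E; case: ifP => // _; case: ifP.
rewrite row1E; case: ifP => // _; case: ifP => [_|_]; last by case: ifP.
by move: zz; case: z {row1E}.
Qed.

Lemma NSym_row (M : 'M[symbol]_(n.+1, d.+1)) (q : 'I_n.+1) i q0
    (N : {group 'S_q0}) :
  fC_matrix M -> M q i = NSym N -> q0 = q.
Proof.
move=> fM E; have [q2|q2] := ltnP q 2.
  by have := row01_symbol i fM q2; rewrite E.
have [E'|E'|[N' _ E']] := fC_row_ge2 i fM q2; rewrite E in E' => //.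
by case: E'.
Qed.

(** Reflexivity handles the pairs of (fC1), where M2 may have any symbol. *)
Lemma cg_refl (M : 'M[symbol]_(n.+1, d.+1)) x : fC_matrix M -> cg M x x.
Proof.
move=> fM; case: x => [[i a]|]; last exact: cg_fC8.
apply/(cg_cell _ _ _ _ fM); split=> //.
case E: (M (rk a) i) => [| | | | |q N] //; rewrite ?greenR_refl ?greenL_refl //.
  by split=> //; left.
split=> //; first by rewrite /greenH greenR_refl greenL_refl.
have qE : q = rank a by have := NSym_row fM E.
case: _ / (esym qE) N {E} => N.
by exists 1%g; [apply: partial_perm_id | apply: group1].
Qed.

Section Backward.
Variables (z1 z2 : symbol) (u0 m0 s u1 m1 u0' m0' s' u1' m1' : nat).
Hypotheses (zz1 : z1 \in zetas) (zz2 : z2 \in zetas).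
Hypotheses (sh1 : rows_shape M1 z1 u0 m0 s u1 m1)
           (sh2 : rows_shape M2 z2 u0' m0' s' u1' m1').
Hypothesis le12 : le_fC M1 M2.
Hypothesis muin12 : fRT2 M1 \/ fRT4 M1 ->
  (min0 M2 <= muin0 M1 /\ min1 M2 <= muin1 M1) \/
  ((fRT2 M2 \/ fRT4 M2) /\
   ((min1 M2)%:Z - (min0 M2)%:Z = (min1 M1)%:Z - (min0 M1)%:Z)%R).

(** Under (b1) both cells of M2 are R.  Under (b2) the same translation matches
    the first R of both rows of M2, so that the cells become R together. *)
Lemma le_linked (i j : 'I_d.+1) :
  M1 (row0 n) i = Mu -> M1 (row1 n) j = Mu -> i + m1 = j + m0 ->
  (M2 (row0 n) i = RR /\ M2 (row1 n) j = RR) \/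
  [/\ M2 (row0 n) i = Mu, M2 (row1 n) j = Mu & m1 + m0' = m0 + m1'].
Proof.
move=> Mi Mj ij; have iu := shape_Mu0 sh1 Mi.
have um : u0 < m0 by lia.
have mu := shape_mu_types sh1 fM1 um.
have := muin12 mu; have [-> ->] := shape_muin sh1 zz1 mu.
rewrite !(shape_min0 sh1, shape_min0 sh2).
rewrite !(shape_min1 sh1 zz1, shape_min1 sh2 zz2).
have [_ _ _ prof] := sh1.
case=> [[m0'u m1'u]|[_ m'E]].
  left; split; first by apply/(shape_R0 sh2); lia.
  by apply/(shape_R1 sh2 _ zz2); case: prof; lia.
have [iR|im] := leqP m0' i.
  left; split; first exact/(shape_R0 sh2).
  by apply/(shape_R1 sh2 _ zz2); lia.
have := le12 (row0 n) i; rewrite Mi.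
case/le_symbolP=> [/(shape_R0 sh2)|M2i]; first lia.
have := le12 (row1 n) j; rewrite Mj.
case/le_symbolP=> [/(shape_R1 sh2 _ zz2)|M2j]; first lia.
by right; split=> //; lia.
Qed.

(** An arrow occurs only as zeta, so that two arrows are in the same cell. *)
Lemma arrow_cell q i : M1 q i = MuUp \/ M1 q i = MuDown ->
  q = row1 n /\ i = s :> nat.
Proof.
have [row0E row1E _ prof] := sh1.
have [->|->|q2] := row_cases q.
- by rewrite row0E; case: ifP => [_|_]; [case | case: ifP => [_|_] []].
- rewrite row1E; case: ltnP => [_ []|si] //.
  case: ltnP => [iu _|_]; last by case: ifP => [_|_] [].
  by split=> //; case: prof; lia.
have [->|->|[N _ ->]] := fC_row_ge2 i fM1 q2; by case.
Qed.

Lemma Mu_row q i : M1 q i = Mu -> q = row0 n \/ q = row1 n.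
Proof.
have [->|->|q2] := row_cases q; [by left | by right |].
by have [->|->|[N _ ->]] := fC_row_ge2 i fM1 q2.
Qed.

Lemma le_inclusion x y : cg M1 x y -> cg M2 x y.
Proof.
have leR q i : M1 q i = RR -> M2 q i = RR.
  by move=> E; have := le12 q i; rewrite E => /le_symbolP[].
case: x => [[i a]|]; case: y => [[j b]|] H; last exact: cg_fC8; last 2 first.
- by inversion H; apply/cg_fC7_left/leR.
- by inversion H; apply/cg_fC7_right/leR.
move: H => /(cg_cell _ _ _ _ fM1)[].
have := le12 (rk a) i.
case E: (M1 (rk a) i) => [| | | | |q N] /le_symbolP leE Eb.
- by case=> -> ->; apply: cg_refl.
- have [ra is_s] := arrow_cell (or_introl E).
  have [rb js_s] := arrow_cell (or_introl Eb).
  have ij : i = j by apply: val_inj; rewrite /= is_s.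
  case=> hab gab; apply/(cg_cell _ _ _ _ fM2).
  rewrite -ij {1}rb -ra; split=> //.
  case: leE => [->|[]->] //; split=> //; left.
  by rewrite ra rb.
- have [ra is_s] := arrow_cell (or_intror E).
  have [rb js_s] := arrow_cell (or_intror Eb).
  have ij : i = j by apply: val_inj; rewrite /= is_s.
  case=> hab gab; apply/(cg_cell _ _ _ _ fM2).
  rewrite -ij {1}rb -ra; split=> //.
  case: leE => [->|[]->] //; split=> //; left.
  by rewrite ra rb.
- case=> hab link; apply/(cg_cell _ _ _ _ fM2).
  have same : (rk a, i) = (rk b, j) -> M2 (rk b) j = M2 (rk a) i /\
      match M2 (rk a) i with
      | Mu => hat a = hat b /\
          ((rk a, i) = (rk b, j) \/
           (i%:Z - j%:Z = (minR M2 (rk a))%:Z - (minR M2 (rk b))%:Z)%R)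
      | RR => True
      | _ => False
      end.
    move=> cell; have ij : i = j := congr1 snd cell.
    have rab : rk a = rk b := congr1 fst cell.
    rewrite -rab -ij; split=> //.
    by case: leE => [->|->] //; split=> //; left.
  case: link => [cell|link]; first by case: (same cell) => ->; case: (M2 _ _).
  have [rab|rab] := eqVneq (rk a) (rk b).
    have ij : i = j by apply: ord_inj; rewrite rab in link; lia.
    by case: (same (congr2 pair rab ij)) => ->; case: (M2 _ _).
  have m0E := shape_min0 sh1; have m1E := shape_min1 sh1 zz1.
  have m0E' := shape_min0 sh2; have m1E' := shape_min1 sh2 zz2.
  rewrite /min0 in m0E m0E'; rewrite /min1 in m1E m1E'.
  have [ra|ra] := Mu_row E; have [rb|rb] := Mu_row Eb;
    rewrite ra rb in rab E Eb link *;
    [by rewrite eqxx in rab | | | by rewrite eqxx in rab].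
  + rewrite m0E m1E in link.
    case: (le_linked E Eb) => [|[-> ->]|[-> -> dE]]; [lia | by [] |].
    by split=> //; split=> //; right; rewrite m0E' m1E'; lia.
  rewrite m0E m1E in link.
  case: (le_linked Eb E) => [|[-> ->]|[-> -> dE]]; [lia | by [] |].
  by split=> //; split=> //; right; rewrite m0E' m1E'; lia.
- by move=> _; apply: cg_fC2; apply: leR.
case=> ij gab [p pab pN]; apply/(cg_cell _ _ _ _ fM2).
have rab : rk a = rk b.
  by apply: ord_inj; rewrite -(NSym_row fM1 E) -(NSym_row fM1 Eb).
rewrite -rab -ij; split=> //.
case: leE => [->|[N' /subsetP sN ->]] //; split=> //.
by exists p => //; apply: sN.
Qed.
End Backward.
End Comparison.

Theorem theorem7p4 (n d : nat) (M1 M2 : 'M[symbol]_(n.+1, d.+1))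
    (hn : 1 <= n) (hM1 : fC_matrix M1) (hM2 : fC_matrix M2)
    (hzeta : n = 1 -> exists2 z, z \in zetas & zeta_is z M1 && zeta_is z M2) :
  (forall x y : twisted n d, cg M1 x y -> cg M2 x y) <->
  le_fC M1 M2 /\
  (fRT2 M1 \/ fRT4 M1 ->
    (min0 M2 <= muin0 M1 /\ min1 M2 <= muin1 M1) \/
    ((fRT2 M2 \/ fRT4 M2) /\
     ((min1 M2)%:Z - (min0 M2)%:Z = (min1 M1)%:Z - (min0 M1)%:Z)%R)).
Proof.
have [z1 [z2 [zz1 zz2 zE [zM1 zM2]]]] : exists z1 z2,
    [/\ z1 \in zetas, z2 \in zetas, n = 1 -> z1 = z2
      & zeta_is z1 M1 /\ zeta_is z2 M2].
  have [n1|n1] := eqVneq n 1.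
    by have [z zz /andP[zM1 zM2]] := hzeta n1; exists z, z.
  have [z1 zz1 zM1] := fC_zeta hM1; have [z2 zz2 zM2] := fC_zeta hM2.
  by exists z1, z2; split=> // n1'; rewrite n1' eqxx in n1.
have [u0 [m0 [s [u1 [m1 sh1]]]]] := rows_shape_exists zM1.
have [u0' [m0' [s' [u1' [m1' sh2]]]]] := rows_shape_exists zM2.
split=> [sub12|[le12 muin12]].
  split; first exact: inclusion_le sh1 sh2 zE.
  exact: inclusion_muin sh1 sh2.
exact: le_inclusion sh1 sh2 le12 muin12.
Qed.
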